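(* Let $(X,q)$ be a finite-dimensional asymmetric normed space (i.e. $X$ is a finite-dimensional real vector space), endowed with the topology induced by $q$. Let $\theta_q=\{x\in X: q(x)=0\}$ and let $Y=\langle\theta_q\rangle$ be the linear span of $\theta_q$. (1) If $Y=X$, then $\dim X=0$. (2) If $\{0\}\neq Y\neq X$, then $\dim X=\infty$. (3) If $Y=\{0\}$, then $\dim X=\dim_a X$. Here $\dim X$ is the covering dimension of the topological space $(X,q)$ and $\dim_a X$ is the algebraic (vector space) dimension of $X$.
   Context: An asymmetric norm on a real vector space $X$ is a function $q:X\to[0,\infty)$ such that $q(ax)=aq(x)$ for all $a\ge 0$, $q(x+y)\le q(x)+q(y)$, and $q(x)=q(-x)=0$ implies $x=0$. The pair $(X,q)$ is an asymmetric normed space; its topology is generated by the open balls $B_q(x,\epsilon)=\{y\in X: q(y-x)<\epsilon\}$, $x\in X$, $\epsilon>0$. Covering dimension (no separation axioms assumed): the order of a family of nonempty sets $\{A_i: i\in I\}$ is the maximum $n\in\mathbb{N}\cup\{0\}$ for which there is $M\subseteq I$ with $|M|=n+1$ and $\bigcap_{i\in M}A_i\neq\emptyset$ (and $\infty$ if there is no such maximum). The covering dimension $\dim X$ of a topological space $X$ is the minimum $n\in\mathbb{N}\cup\{0\}$ such that every finite open cover of $X$ has an open refinement (covering $X$) of order not exceeding $n$, or $\infty$ if there is no such $n$. *)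

(* Defs.v *)
From HB Require Import structures.
From mathcomp Require Import all_boot all_order all_algebra.
From mathcomp Require Import all_classical all_reals all_analysis.

Set Implicit Arguments.
Unset Strict Implicit.
Unset Printing Implicit Defensive.

Import Order.TTheory GRing.Theory Num.Theory.

Local Open Scope classical_set_scope.
Local Open Scope ring_scope.

Record asymNorm (R : realType) (X : lmodType R) := AsymNorm {
  asym_norm :> X -> R ;
  asym_norm_ge0 : forall x, 0 <= asym_norm x ;
  asym_normZ : forall a x, 0 <= a -> asym_norm (a *: x) = a * asym_norm x ;
  asym_normD : forall x y, asym_norm (x + y) <= asym_norm x + asym_norm y ;
  asym_norm_eq0 : forall x, asym_norm x = 0 -> asym_norm (- x) = 0 -> x = 0
}.

Definition asym_ball (R : realType) (X : lmodType R) (q : asymNorm X)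
  (x : X) (e : R) : set X := [set y | q (y - x) < e].

(* A copy of [X] that carries the topology induced by [q]. *)
Definition asym_space (R : realType) (X : lmodType R) (q : asymNorm X) : Type :=
  X.

HB.instance Definition _ (R : realType) (X : lmodType R) (q : asymNorm X) :=
  Choice.on (asym_space q).

Section AsymTopology.
Context (R : realType) (X : lmodType R) (q : asymNorm X).

(* Pairs (centre, radius); the base of a topology needs a pointed index type. *)
Definition asym_ball_index : Type := (X * R)%type.

HB.instance Definition _ := Choice.on asym_ball_index.
HB.instance Definition _ := isPointed.Build asym_ball_index (0, 0).

Let D : set asym_ball_index := [set p | 0 < p.2].
Let b (p : asym_ball_index) : set (asym_space q) := asym_ball q p.1 p.2.

Lemma asym_norm0 : q 0 = 0.
Proof. by rewrite -(scale0r 0) asym_normZ// mul0r. Qed.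

Lemma asym_ball_cover : \bigcup_(p in D) b p = setT.
Proof.
apply/seteqP; split=> // x _; exists ((x : X), 1) => /=; first exact: ltr01.
by rewrite /b /asym_ball /= subrr asym_norm0 ltr01.
Qed.

Lemma asym_ball_join (i j : asym_ball_index) (t : asym_space q) :
  D i -> D j -> b i t -> b j t ->
  exists k, [/\ D k, b k t & b k `<=` b i `&` b j].
Proof.
move=> _ _; rewrite /b /asym_ball /= => it jt.
exists ((t : X), Num.min (i.2 - q ((t : X) - i.1)) (j.2 - q ((t : X) - j.1))).
split=> /=.
- by rewrite /D /= lt_min !subr_gt0 it jt.
- by rewrite subrr asym_norm0 lt_min !subr_gt0 it jt.
- move=> y /=; rewrite lt_min !ltrBrDr => /andP[iy jy].
  by split; [apply: le_lt_trans iy | apply: le_lt_trans jy];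
    rewrite -[leLHS](congr1 q (subrKA (t : X) _ _)) asym_normD.
Qed.

HB.instance Definition _ := isBaseTopological.Build (asym_space q)
  asym_ball_cover asym_ball_join.

End AsymTopology.

Definition theta (R : realType) (X : lmodType R) (q : asymNorm X) : set X :=
  [set x | q x = 0].

Definition linear_span (R : realType) (X : vectType R) (A : set X) : set X :=
  [set x | exists2 s : seq X, [set` s] `<=` A & x \in span s].

(* The orders and dimensions below are natural numbers or +oo, embedded in
   \bar R: the supremum of a nonempty set of naturals is its maximum, or +oo if
   it has none; the infimum is its minimum, or +oo if the set is empty. *)

Definition cover_order (R : realType) (T J : Type) (V : J -> set T) : \bar R :=
  ereal_sup [set n%:R%:E | n in [set n : nat | exists M : set J,
    (M #= `I_n.+1)%card /\ \bigcap_(j in M) V j !=set0]].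

Definition open_cover (T : topologicalType) (I : Type) (U : I -> set T) : Prop :=
  (forall i, open (U i)) /\ cover setT U = setT.

Definition refines (T I J : Type) (V : J -> set T) (U : I -> set T) : Prop :=
  forall j, exists i, V j `<=` U i.

Definition covering_dim (R : realType) (T : topologicalType) : \bar R :=
  ereal_inf [set n%:R%:E | n in [set n : nat |
    forall (I : finType) (U : I -> set T), open_cover U ->
    exists (J : Type) (V : J -> set T),
      [/\ forall j, V j !=set0, open_cover V, refines V U &
          (cover_order R V <= n%:R%:E)%E]]].

(* Main.v *)
(** The sets open for [q] are stable under translation by the cone [theta q].

    If [theta q] spans [X], it has an interior point [p], and one member of any
    finite cover contains [- n p] for infinitely many [n], hence everything.

    If [theta q] spans a proper nonzero subspace [Y], fix a relatively interior
    point [p] of [theta q] and [w] outside [Y].  In a refinement of finite order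
    every line parallel to [p] lies in a single member.  Take compact sets of
    reals [K 0 = set0], [K 1], [K 2], ... such that every point of [K k] is a
    limit of points of [K k.+1] outside [K k]; the latter have level [k].  There
    is a cover such that, for [t] of level [k], the line through [t w] lies in
    its [k]-th member only.  Choosing reals [t_0], ..., [t_n] of levels 0, ..., n,
    each very close to its predecessor, gives n + 1 distinct members of the
    refinement through [t_n w].

    If [theta q] is trivial, [q] defines the topology of R^n.  For the upper
    bound, n + 1 pairwise disjoint dense grids yield n + 1 families of disjoint
    open bricks; a point has only n coordinates, so it avoids the brick walls of
    at least one family.  The lower bound is Lebesgue's covering theorem,
    obtained from Sperner's lemma on the triangulated cube. *)

Require Import Defs.
From HB Require Import structures.
From mathcomp Require Import all_boot all_order all_algebra all_fingroup.
From mathcomp Require Import all_classical all_reals all_analysis.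
From mathcomp Require Import zify ring lra.

Set Implicit Arguments.
Unset Strict Implicit.
Unset Printing Implicit Defensive.

(** * Sperner's lemma on the cube *)

(* The n! monotone lattice paths across a unit cube triangulate it: [p.1] is the
   lowest corner of the cube, and the path runs along axis [i] at step [p.2 i]. *)
Definition kuhn_simplex (n N : nat) := ({ffun 'I_n -> 'I_N.+1} * 'S_n)%type.

Definition kuhn_vertex (n N : nat) (p : kuhn_simplex n N) (k : nat)
  : {ffun 'I_n -> nat} := [ffun i => p.1 i + (p.2 i < k)].

Definition rainbow (n : nat) (f : 'I_n.+1 -> nat) : bool :=
  [forall c : 'I_n.+1, exists j, f j == c].

(** The doors of the usual proof of Sperner's lemma: the facet opposite vertex [k] shows all labels
    below n. *)
Definition door (n : nat) (f : 'I_n.+1 -> nat) (k : 'I_n.+1) : bool :=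
  [forall c : 'I_n, exists j, f (lift k j) == c].

Lemma xor_pred1 (T : finType) (x : T) : \big[addb/false]_y (y == x) = true.
Proof.
rewrite (bigD1 x) //= eqxx big1 // => y /negbTE -> //.
Qed.

(** Counts modulo 2 are written as iterated xors; [h] matches the points where [b] holds with those
    where it fails, so equal values cancel. *)
Lemma xor_involution (T : finType) (h : T -> T) (b F : pred T) :
  involutive h -> (forall x, b (h x) = ~~ b x) -> (forall x, F (h x) = F x) ->
  \big[addb/false]_x F x = false.
Proof.
move=> hK bh Fh; rewrite (bigID b) /=.
rewrite [X in _ (+) X](reindex_inj (inv_inj hK)) /=.
rewrite [X in _ (+) X](eq_bigl b) ?[X in _ (+) X](eq_bigr F) ?addbb //.
by move=> x; rewrite bh negbK.
Qed.

(** A rainbow simplex has one door, opposite its vertex labelled n. Any other simplex with a door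
    has exactly two, opposite the two vertices that share a label. *)
Lemma door_parity (n : nat) (f : 'I_n.+1 -> nat) : (forall j, f j <= n) ->
  \big[addb/false]_k door f k = rainbow f.
Proof.
move=> fn; pose g j : 'I_n.+1 := inord (f j).
have gE j : g j = f j :> nat by rewrite inordK // ltnS.
have doorP k :
    reflect (forall c, c < n -> exists2 j, j != k & f j = c) (door f k).
  apply: (iffP forallP) => [H c cn|H c].
    have /existsP[j /eqP fj] := H (Ordinal cn).
    by exists (lift k j); rewrite // eq_sym neq_lift.
  have [j jk fj] := H _ (ltn_ord c); apply/existsP.
  have [j' jj'|jj'] := unliftP k j; last by rewrite jj' eqxx in jk.
  by exists j'; rewrite -jj' fj.
have doorP' k : reflect
    (forall c : 'I_n.+1, c < n -> exists2 j, j != k & g j = c) (door f k).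
  apply: (iffP (doorP k)) => [H c cn|H c cn].
    by have [j jk fj] := H c cn; exists j => //; apply: val_inj; rewrite /= gE.
  have [j jk gj] := H (inord c) ltac:(rewrite inordK // ltnW //).
  by exists j; rewrite // -gE gj inordK // ltnW.
have [R|R] := boolP (rainbow f).
  have ginj : {in [set: 'I_n.+1] &, injective g}.
    apply/imset_injP; rewrite cardsT -cardsT; apply/eqP/eq_card => c.
    rewrite !inE; have /existsP[j /eqP fj] := forallP R c.
    by apply/imsetP; exists j => //; apply: val_inj; rewrite /= gE.
  have /existsP[k0 /eqP fk0] := forallP R ord_max.
  rewrite -[RHS](xor_pred1 k0); apply: eq_bigr => k _; apply/doorP/eqP.
    move=> H; apply: (ginj) => //; apply/val_inj => /=; rewrite !gE fk0.
    apply/eqP; rewrite eqn_leq fn leqNgt; apply/negP => /H[j jk fj].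
    by move/eqP: jk; apply; apply: (ginj) => //; apply/val_inj; rewrite /= !gE.
  move=> -> c cn.
  have /existsP[j /eqP fj] := forallP R (Ordinal (ltnW cn : c < n.+1)).
  exists j => //; apply/eqP => jk0.
  by have := cn; rewrite -[c]fj jk0 fk0 ltnn.
have [/existsP[k0 D0]|D] := boolP [exists k, door f k]; last first.
  rewrite big1 // => k _; apply/negbTE; apply: contra D => Dk.
  by apply/existsP; exists k.
have fk0 : f k0 < n.
  rewrite ltn_neqAle fn andbT; apply: contra R => /eqP fk0.
  apply/forallP => c; have [cn|] := ltnP c n.
    by have [j _ <-] := doorP _ D0 _ cn; apply/existsP; exists j.
  move=> nc; apply/existsP; exists k0; rewrite fk0 eqn_leq nc.
  by rewrite -ltnS ltn_ord.
have [k1 k10 gk1] := doorP' _ D0 (g k0) ltac:(rewrite gE //).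
rewrite (eq_bigr (fun k => (k == k0) (+) (k == k1))).
  by rewrite big_split /= !xor_pred1.
move=> k _; have [->|kk0] := eqVneq k k0; first by rewrite eq_sym (negbTE k10).
have [->|kk1] := eqVneq k k1.
  apply/doorP' => c /(doorP' _ D0)[j jk0 gj].
  have [jk1|jk1] := eqVneq j k1; last by exists j.
  by exists k0; [rewrite eq_sym|rewrite -gk1 -jk1].
apply/negbTE/negP => /doorP' Dk.
(* A third door would show n labels on n - 1 vertices, as the label of [k1] is also that of [k0]. *)
have sub : [set c : 'I_n.+1 | c < n] \subset g @: ([set: 'I_n.+1] :\ k :\ k1).
  apply/fintype.subsetP => c; rewrite inE => /Dk[j jk <-].
  have [->|jk1] := eqVneq j k1; last by apply: imset_f; rewrite !inE jk jk1.
  by rewrite gk1; apply: imset_f; rewrite !inE eq_sym k10 eq_sym kk0.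
have := leq_trans (subset_leq_card sub) (leq_imset_card _ _).
have -> : [set c : 'I_n.+1 | c < n] = [set: 'I_n.+1] :\ ord_max.
  apply/setP => c; rewrite !inE andbT -val_eqE /=.
  by rewrite ltn_neqAle -ltnS ltn_ord andbT.
have cT (A : {set 'I_n.+1}) c : c \in A -> #|A :\ c| = #|A|.-1.
  by move=> cA; rewrite [#|A|](cardsD1 c) cA.
have k2 : k1 \in [set: 'I_n.+1] :\ k by rewrite !inE eq_sym kk1.
have : #|[set: 'I_n.+1] :\ k| != 0.
  by rewrite cards_eq0; apply/finset.set0Pn; exists k1.
rewrite (cT _ _ k2) !cT ?inE // cardsT card_ord /=.
by case: (n) => // m; rewrite ltnn.
Qed.

Section Rotation.
Variables n N : nat.
Implicit Type p : kuhn_simplex n.+1 N.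

Definition rot_axis p : 'I_n.+1 := (p.2^-1)%g ord0.

(* The facet of [p] opposite its first vertex is the facet of [kuhn_rot p]
   opposite its last one, unless it lies on the far face of the big cube, where
   the corner wraps around to keep [kuhn_rot] a bijection. *)
Definition kuhn_rot p : kuhn_simplex n.+1 N :=
  ([ffun i => if i == rot_axis p then ordS (p.1 i) else p.1 i],
   (p.2 * perm (@ord_pred_inj n.+1))%g).

Lemma kuhn_rot_inj : injective kuhn_rot.
Proof.
move=> p p' [/ffunP x /mulIg s]; case: p p' s x => [x s] [x' s'] /= <- {s'}.
move=> E; congr pair; apply/ffunP => i; have := E i; rewrite !ffunE /rot_axis /=.
by case: eqP => // _ /ordS_inj.
Qed.

Lemma kuhn_rot2 p i : i != rot_axis p -> (kuhn_rot p).2 i = (p.2 i).-1 :> nat.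
Proof.
move=> ip; rewrite permM permE /=; have : p.2 i != ord0.
  by apply: contra ip => /eqP pi; rewrite /rot_axis -pi permK.
rewrite -val_eqE /=; have := ltn_ord (p.2 i).
case: (val (p.2 i)) => // m mn _ /=.
by rewrite modnDr modn_small // ltnW.
Qed.

Lemma kuhn_rot2_axis p : (kuhn_rot p).2 (rot_axis p) = ord_max.
Proof.
rewrite permM permE /rot_axis permKV; apply/val_inj => /=.
by rewrite modn_small.
Qed.

Lemma rot_axisE p : ((kuhn_rot p).2^-1)%g ord_max = rot_axis p.
Proof. by rewrite -(kuhn_rot2_axis p) permK. Qed.

Lemma kuhn_rot_vertex p k : p.1 (rot_axis p) < N -> k <= n ->
  kuhn_vertex (kuhn_rot p) k = kuhn_vertex p k.+1.
Proof.
move=> pN kn; apply/ffunP => i; rewrite !ffunE.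
have [->|ip] := eqVneq i (rot_axis p).
  rewrite kuhn_rot2_axis /= modn_small // [n < k]ltnNge kn.
  by rewrite /rot_axis permKV /= addn0 addn1.
rewrite kuhn_rot2 //; congr (_ + nat_of_bool _).
have : p.2 i != ord0 by apply: contra ip => /eqP pi; rewrite /rot_axis -pi permK.
by rewrite -val_eqE /=; case: (val (p.2 i)).
Qed.

End Rotation.

(** Swapping the steps k - 1 and k of a path moves only its vertex [k], hence preserves the opposite
    facet; it also changes the sign of [p.2]. *)
Lemma kuhn_swap_parity (n N : nat) (F : {ffun 'I_n.+1 -> nat} -> nat)
    (k : 'I_n.+2) : 0 < k < n.+1 ->
  \big[addb/false]_(p : kuhn_simplex n.+1 N)
    door (fun j => F (kuhn_vertex p j)) k = false.
Proof.
move=> /andP[k0 kn].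
have kn' : k.-1 < n.+1 by rewrite ltnW // prednK.
pose t : 'S_n.+1 := tperm (Ordinal kn') (Ordinal kn).
pose h (p : kuhn_simplex n.+1 N) := (p.1, (p.2 * t)%g).
apply: (@xor_involution _ h (fun p => odd_perm p.2)) => [[x s]|[x s]|[x s]].
- by rewrite /h /= -mulgA tperm2 mulg1.
- rewrite /h /= odd_permM odd_tperm addbC; case: eqP => // /(congr1 val) /= E.
  by move: k0 E; case: (val k) => // m _ /eqP; rewrite /= ltn_eqF.
apply: eq_forallb => c; apply: eq_existsb => j; congr (F _ == _).
apply/ffunP => i; rewrite !ffunE /= permM; congr (_ + nat_of_bool _).
have : lift k j != k :> nat by rewrite eq_sym (neq_lift k j).
rewrite /t; case: tpermP => [->|->|//] /=; lia.
Qed.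

(** [kuhn_rot] cancels facets opposite a first vertex against facets opposite a last one. Left over
    are facets on the boundary of the big cube, where the labelling forbids doors unless the last
    coordinate is 0. *)
Lemma kuhn_facets_parity (n N : nat) (F : {ffun 'I_n.+1 -> nat} -> nat) :
  (forall v : {ffun _}, (forall i, v i <= N.+1) ->
    forall i, v i = N.+1 -> F v <> i) ->
  (forall v : {ffun _}, (forall i, v i <= N.+1) ->
    forall i, v i = 0 -> F v <= i) ->
  let D (p : kuhn_simplex n.+1 N) k :=
    door (fun j : 'I_n.+2 => F (kuhn_vertex p j)) k in
  \big[addb/false]_p D p ord0 (+) \big[addb/false]_p D p ord_max =
  \big[addb/false]_(p : kuhn_simplex n.+1 N |
      (p.1 ord_max == ord0) && (p.2 ord_max == ord_max)) D p ord_max.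
Proof.
move=> FN F0 D.
have vN (p : kuhn_simplex n.+1 N) k i : kuhn_vertex p k i <= N.+1.
  rewrite ffunE; apply: (leq_trans (leq_add _ (leq_b1 _))); last by rewrite addn1.
  by rewrite -ltnS.
rewrite [X in _ (+) X](reindex_inj (@kuhn_rot_inj n N)) /= -big_split /=.
pose G (p : kuhn_simplex n.+1 N) :=
  (p.1 ((p.2^-1)%g ord_max) == ord0) && D p ord_max.
transitivity (\big[addb/false]_p G (kuhn_rot p)).
  apply: eq_bigr => p _; rewrite /G rot_axisE ffunE eqxx.
  have := ltn_ord (p.1 (rot_axis p)); rewrite ltnS leq_eqVlt => /orP[/eqP pN|pN].
    have -> : ordS (p.1 (rot_axis p)) == ord0.
      by rewrite -val_eqE /= pN modnn.
    suff -> : D p ord0 = false by rewrite addFb.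
    apply/negbTE/negP => /forallP/(_ (rot_axis p))/existsP[j /eqP].
    apply: FN => //; rewrite ffunE pN /rot_axis permKV /=.
    by rewrite addn1.
  have -> : D p ord0 = D (kuhn_rot p) ord_max.
    apply: eq_forallb => c; apply: eq_existsb => j.
    by rewrite lift0 lift_max -kuhn_rot_vertex // -ltnS.
  by rewrite addbb -val_eqE /= modn_small.
rewrite -(reindex_inj (P := xpredT) (F := G) (@kuhn_rot_inj n N)).
rewrite [RHS]big_mkcond /=.
apply: eq_bigr => p _; rewrite /G.
case: (boolP (D p ord_max)) => [Dp|]; last by rewrite andbF if_same.
rewrite andbT.
have -> : (p.2 ord_max == ord_max) = ((p.2^-1)%g ord_max == ord_max).
  by apply/eqP/eqP => E; rewrite -{1}E (permK, permKV).
have [->|m] := eqVneq ((p.2^-1)%g ord_max) ord_max; first by case: eqP.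
rewrite andbF; case: eqP => //= p0.
have /existsP[j /eqP E] := forallP Dp ord_max.
have : F (kuhn_vertex p (lift ord_max j)) <= (p.2^-1)%g ord_max.
  by apply: F0 => //; rewrite ffunE p0 permKV lift_max /= ltnNge -ltnS ltn_ord.
by rewrite E /= leqNgt ltn_neqAle -ltnS ltn_ord andbT; case/negP.
Qed.

Lemma lift_perm_onto (n : nat) (i : 'I_n.+1) (s : 'S_n.+1) :
  s i = i -> exists s', s = lift_perm i i s'.
Proof.
move=> si; have sl j : {j' | s (lift i j) = lift i j'}.
  have [j' E|E] := unliftP i (s (lift i j)); first by exists j'.
  by have := neq_lift i j; rewrite -(inj_eq (@perm_inj _ s)) si E eqxx.
have s_inj : injective (fun j => projT1 (sl j)).
  move=> j1 j2; case: (sl j1) => j1' E1; case: (sl j2) => j2' E2 /= E.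
  by move: E1; rewrite E -E2 => /perm_inj/lift_inj.
exists (perm s_inj); apply/permP => j; have [j' ->|->] := unliftP i j.
  by rewrite lift_perm_lift permE; case: (sl j').
by rewrite lift_perm_id.
Qed.

(** Induction on the dimension. Rainbow simplices are counted by their doors; those opposite middle
    vertices cancel, the others reduce to the face where the last coordinate is 0, a triangulated
    cube of one dimension less. *)
Lemma kuhn_parity (n N : nat) (F : {ffun 'I_n -> nat} -> nat) :
  (forall v : {ffun _}, (forall i, v i <= N.+1) -> F v <= n) ->
  (forall v : {ffun _}, (forall i, v i <= N.+1) ->
    forall i, v i = N.+1 -> F v <> i) ->
  (forall v : {ffun _}, (forall i, v i <= N.+1) ->
    forall i, v i = 0 -> F v <= i) ->
  \big[addb/false]_(p : kuhn_simplex n N)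
    rainbow (fun j : 'I_n.+1 => F (kuhn_vertex p j)) = true.
Proof.
elim: n F => [|n IHn] F Fn FN F0.
  pose p0 : kuhn_simplex 0 N := (finfun (fun i : 'I_0 => ord0), 1%g).
  rewrite (eq_bigl (pred1 p0)).
    rewrite big_pred1_eq; apply/forallP => c; apply/existsP; exists ord0.
    have := ltn_ord c; rewrite ltnS leqn0 => /eqP ->.
    by rewrite -leqn0 Fn // => -[].
  move=> [x s]; apply/esym/eqP; congr pair; first by apply/ffunP => -[].
  by apply/permP => -[].
rewrite (eq_bigr (fun p => \big[addb/false]_k
  door (fun j : 'I_n.+2 => F (kuhn_vertex p j)) k)); last first.
  move=> p _; rewrite door_parity // => j; apply: Fn => i.
  rewrite ffunE; apply: (leq_trans (leq_add _ (leq_b1 _))); last by rewrite addn1.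
  by rewrite -ltnS.
rewrite exchange_big big_ord_recl big_ord_recr /=.
rewrite [X in _ (+) (X (+) _)]big1 ?addFb; last first.
  by move=> k _; rewrite kuhn_swap_parity //= /bump leq0n /= ltnS ltn_ord.
have -> : lift ord0 ord_max = ord_max :> 'I_n.+2 by apply: val_inj.
rewrite kuhn_facets_parity //.
(* Embed the smaller cube as that face; the paths take the last axis at their final step, whose
   endpoint is the dropped vertex. *)
pose ext (x : {ffun 'I_n -> 'I_N.+1}) : {ffun 'I_n.+1 -> 'I_N.+1} :=
  [ffun i => if unlift ord_max i is Some j then x j else ord0].
pose extv (v : {ffun 'I_n -> nat}) : {ffun 'I_n.+1 -> nat} :=
  [ffun i => if unlift ord_max i is Some j then v j else 0].
pose h (p : kuhn_simplex n N) : kuhn_simplex n.+1 N :=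
  (ext p.1, lift_perm ord_max ord_max p.2).
have h_inj : injective h.
  move=> [x s] [x' s'] [/ffunP E /permP E']; congr pair.
    by apply/ffunP => i; have := E (lift ord_max i); rewrite !ffunE liftK.
  apply/permP => i; have := E' (lift ord_max i); rewrite !lift_perm_lift.
  exact: lift_inj.
have hE : [pred p : kuhn_simplex n.+1 N | (p.1 ord_max == ord0) &&
    (p.2 ord_max == ord_max)] =i [set h p | p in [set: kuhn_simplex n N]].
  move=> [x s]; rewrite !inE /=; apply/andP/imsetP => [[/eqP x0 /eqP sm]|].
    have [s' ->] := lift_perm_onto sm.
    exists ([ffun i => x (lift ord_max i)], s'); first by rewrite inE.
    rewrite /h /=; congr pair.
    apply/ffunP => i; rewrite ffunE; case: unliftP => [j ->|->]; last exact: x0.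
    by rewrite ffunE.
  case=> -[x' s'] _ [-> ->]; rewrite lift_perm_id eqxx ffunE unlift_none.
  by rewrite eqxx.
rewrite (eq_bigl _ _ hE) big_imset /=; last by move=> ? ? _ _; apply: h_inj.
pose F' v := F (extv v).
have extvN (v : {ffun 'I_n -> nat}) :
    (forall i, v i <= N.+1) -> forall i, extv v i <= N.+1.
  by move=> vN i; rewrite ffunE; case: unliftP.
rewrite -[RHS](IHn F').
- apply: eq_big => [p|[x s] _]; first by rewrite inE.
  apply: eq_forallb => c; apply: eq_existsb => j; rewrite /F' lift_max.
  congr (F _ == _); apply/ffunP => i; rewrite !ffunE /=.
  case: unliftP => [i' ->|->]; rewrite ?ffunE ?lift_perm_lift ?lift_perm_id.
    by rewrite lift_max.
  by rewrite ltnNge -ltnS ltn_ord.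
(* The last coordinate is 0, which excludes the top label. *)
- move=> v /extvN vN; have := F0 _ vN ord_max; rewrite ffunE unlift_none.
  exact.
- move=> v /extvN vN i vi; have := FN _ vN (lift ord_max i).
  by rewrite ffunE liftK lift_max; apply.
- move=> v /extvN vN i vi; have := F0 _ vN (lift ord_max i).
  by rewrite ffunE liftK lift_max; apply.
Qed.

(** An odd number of rainbow simplices is not zero. Only the unit cube around one is recorded, which
    suffices to have all labels close together. *)
Lemma cube_sperner (n N : nat) (F : {ffun 'I_n -> nat} -> nat) :
  (forall v : {ffun _}, (forall i, v i <= N.+1) -> F v <= n) ->
  (forall v : {ffun _}, (forall i, v i <= N.+1) ->
    forall i, v i = N.+1 -> F v <> i) ->
  (forall v : {ffun _}, (forall i, v i <= N.+1) ->
    forall i, v i = 0 -> F v <= i) ->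
  exists x : {ffun 'I_n -> nat}, forall c, c <= n ->
    exists v : {ffun 'I_n -> nat},
      (forall i, x i <= v i <= (x i).+1 /\ v i <= N.+1) /\ F v = c.
Proof.
move=> Fn FN F0; have := kuhn_parity Fn FN F0.
have [/existsP[p R] _|] := boolP [exists p : kuhn_simplex n N,
    rainbow (fun j : 'I_n.+1 => F (kuhn_vertex p j))].
  exists [ffun i => p.1 i : nat] => c cn.
  have /existsP[j /eqP Fj] := forallP R (Ordinal (cn : c < n.+1)).
  exists (kuhn_vertex p j); split=> // i; rewrite !ffunE.
  have := ltn_ord (p.1 i); rewrite /= leq_addr ltnS -(addn1 (p.1 i)).
  rewrite leq_add2l leq_b1 => pN; split=> //.
  by apply: (leq_trans (leq_add pN (leq_b1 _))); rewrite addn1.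
move=> R; rewrite big1 // => p _; apply/negbTE; apply: contra R => Rp.
by apply/existsP; exists p.
Qed.

Import Order.TTheory GRing.Theory Num.Theory.
Import numFieldNormedType.Exports.
Import VectorInternalTheory.

Local Open Scope classical_set_scope.
Local Open Scope ring_scope.

(** * Covers of asymmetric normed spaces *)

Lemma infinite_pigeonhole (I : finType) (f : nat -> I) :
  exists i, forall m, exists2 n, (m <= n)%N & f n = i.
Proof.
apply: contrapT => /forallNP H.
have /choice[g gP] : forall i, exists m, forall n, (m <= n)%N -> f n <> i.
  move=> i; have /existsNP[m Hm] := H i; exists m => n mn fn.
  by apply: Hm; exists n.
pose m := (\max_i g i)%N.
by apply: (gP (f m) m) => //; apply: leq_bigmax.
Qed.

(** * Order of a cover and covering dimension *)

Section CoverOrder.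
Context {R : realType}.

Lemma cover_order_ge (T J : Type) (V : J -> set T) (n : nat)
    (f : 'I_n.+1 -> J) (x : T) :
  injective f -> (forall i, V (f i) x) -> (n%:R%:E <= cover_order R V)%E.
Proof.
move=> f_inj fx; apply: ereal_sup_ubound; exists n => //.
exists (range f); split; last by exists x => _ [i _ <-].
have /card_eq_trans : (range f #= [set: 'I_n.+1])%card.
  by apply: inj_card_eq => i j _ _; apply: f_inj.
by apply; rewrite card_eq_sym; apply: card_II.
Qed.

(** [c] colours the members so that those of one colour are disjoint; a point lies in at most one
    member of each of the n + 1 colours. *)
Lemma cover_order_le (T J : Type) (V : J -> set T) (n : nat)
    (c : J -> 'I_n.+1) :
  (forall j j' x, V j x -> V j' x -> c j = c j' -> j = j') ->
  (cover_order R V <= n%:R%:E)%E.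
Proof.
move=> cV; apply: ub_ereal_sup => _ [m [M [Mm [x xM]]] <-].
rewrite lee_fin ler_nat -ltnS.
have : (M #<= [set: 'I_n.+1])%card.
  have /card_le_eql <- : (c @` M #= M)%card; last exact: subset_card_le.
  apply: inj_card_eq => j j' /set_mem Mj /set_mem Mj'.
  by apply: (cV _ _ x); apply: xM.
by rewrite (card_le_eql Mm) -(card_le_eqr card_II) card_le_II.
Qed.

End CoverOrder.

Section CoveringDim.
Context {R : realType} (T : topologicalType).

Lemma covering_dim_ge (n : nat) (I : finType) (U : I -> set T) :
  open_cover U ->
  (forall (J : Type) (V : J -> set T), open_cover V -> refines V U ->
    (n%:R%:E <= cover_order R V)%E) ->
  (n%:R%:E <= covering_dim R T)%E.
Proof.
move=> cU UV; apply: le_ereal_inf_tmp => _ [m Hm <-].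
have [J [V [_ cV VU Vm]]] := Hm I U cU.
exact: le_trans (UV J V cV VU) Vm.
Qed.

(** The definition asks for nonempty members; discarding the empty ones keeps a cover and does not
    raise the order. *)
Lemma covering_dim_le (n : nat) :
  (forall (I : finType) (U : I -> set T), open_cover U ->
    exists (J : Type) (V : J -> set T), [/\ open_cover V, refines V U &
      (cover_order R V <= n%:R%:E)%E]) ->
  (covering_dim R T <= n%:R%:E)%E.
Proof.
move=> H; apply: ereal_inf_lbound; exists n => // I U cU.
have [J [V [[oV cV] VU Vn]]] := H I U cU.
exists {j : J | V j !=set0}, (fun j => V (projT1 j)); split.
- by case.
- split=> [[j ?]|]; first exact: oV.
  apply/seteqP; split=> // x _.
  have : cover setT V x by rewrite cV.
  by case=> j _ Vjx; exists (exist _ j (ex_intro _ x Vjx)).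
- by move=> [j ?]; have [i] := VU j; exists i.
apply: le_trans Vn; apply: ub_ereal_sup => _ [m [M [Mm [x xM]]] <-].
apply: ereal_sup_ubound; exists m => //; exists [set projT1 j | j in M].
split; last by exists x => _ [j Mj <-]; exact: xM.
apply: card_eq_trans Mm; apply: inj_card_eq => -[j j0] [k k0] _ _ /= jk.
by case: k / jk k0 => k0; congr exist; apply: Prop_irrelevance.
Qed.

Lemma covering_dim_ge0 : (0%:E <= covering_dim R T)%E.
Proof.
by apply: le_ereal_inf_tmp => _ [m _ <-]; rewrite lee_fin ler0n.
Qed.

End CoveringDim.

(** * The cone [theta q], and the case where it spans *)

Section AsymNorm.
Context {R : realType} {X : vectType R} (q : asymNorm X).

Lemma asym_openP (U : set (asym_space q)) :
  open U <-> forall x : X, U x -> exists2 e, 0 < e & asym_ball q x e `<=` U.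
Proof.
split=> [[D _ <-] x [[c r] Dc]|H].
  rewrite /asym_ball /= => xc; exists (r - q ((x : X) - c)); rewrite ?subr_gt0//.
  move=> y /=; rewrite ltrBrDr => yx; exists (c, r) => //=.
  apply: le_lt_trans yx; rewrite -[leLHS](congr1 q (subrKA x _ _)).
  exact: asym_normD.
exists [set p : X * R | 0 < p.2 /\ asym_ball q p.1 p.2 `<=` U].
  by move=> p [].
apply/seteqP; split=> [x [p [_ pU]]|x Ux]; first exact: pU.
have [e e0 eU] := H x Ux; exists ((x : X), e) => //=.
by rewrite /asym_ball /= subrr asym_norm0.
Qed.

Lemma asym_open_theta (U : set (asym_space q)) (x y : X) :
  open U -> U x -> q (y - x) = 0 -> U y.
Proof.
move=> /asym_openP oU /oU[e e0 eU] xy; apply: eU.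
by rewrite /asym_ball /= xy.
Qed.

Lemma thetaD (x y : X) : theta q x -> theta q y -> theta q (x + y).
Proof.
rewrite /theta /= => qx qy; apply/eqP; rewrite eq_le asym_norm_ge0 andbT.
by rewrite (le_trans (asym_normD _ _ _))// qx qy addr0.
Qed.

Lemma thetaZ (a : R) (x : X) : 0 <= a -> theta q x -> theta q (a *: x).
Proof. by move=> a0; rewrite /theta /= asym_normZ // => ->; rewrite mulr0. Qed.

Lemma theta_sum (I : finType) (F : I -> X) :
  (forall i, theta q (F i)) -> theta q (\sum_i F i).
Proof.
move=> F0; apply: (big_ind (theta q)) => //; first exact: asym_norm0.
exact: thetaD.
Qed.

(* A relatively interior point of the cone [theta q]. *)
Lemma theta_core : exists2 p : X, theta q p &
  forall y, linear_span (theta q) y -> exists N : nat, theta q (y + N%:R *: p).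
Proof.
(* Choose vectors of [theta q] whose span has maximal dimension; further vectors of [theta q] cannot
   enlarge it. *)
pose P d := `[< exists s : seq X, [set` s] `<=` theta q /\ \dim (span s) = d >].
have exP : exists d, P d.
  by exists (\dim (span ([::] : seq X))); apply/asboolP; exists [::].
have ubP d : P d -> (d <= \dim {:X})%N.
  by move=> /asboolP[s [_ <-]]; apply: dimvS; apply: subvf.
have [d /asboolP[s [s0 sd]] dmax] := ex_maxnP exP ubP.
have s_max y : linear_span (theta q) y -> y \in span s.
  case=> s' s'0; apply/subvP.
  have ss' : (span s <= span (s ++ s'))%VS by rewrite span_cat addvSl.
  have /eqP <- : span (s ++ s') == span s; last by rewrite span_cat addvSr.
  rewrite eq_sym -(dimv_leqif_eq ss') eqn_leq (dimv_leqif_eq ss') sd dmax //.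
  apply/asboolP; exists (s ++ s'); split=> // x /=.
  by rewrite mem_cat => /orP[/s0|/s'0].
pose t := in_tuple s.
have t0 i : theta q t`_i.
  have [si|si] := leqP (size s) i; last exact/s0/mem_nth.
  by rewrite nth_default //; apply: asym_norm0.
(* Adding N times the sum of these vectors raises all coefficients of [y] by N; they become
   nonnegative for N large. *)
exists (\sum_(i < size s) t`_i); first exact: theta_sum.
move=> y /s_max ys; pose a := \sum_(i < size s) `|coord t i y|.
exists (Num.bound a); rewrite {1}(coord_span (X := t) ys) scaler_sumr -big_split.
apply: theta_sum => i /=; rewrite -scalerDl; apply: thetaZ => //.
have : `|coord t i y| <= a.
  by rewrite /a (bigD1 i) //= lerDl sumr_ge0.
have : a < (Num.bound a)%:R.
  by apply: archi_boundP; apply: sumr_ge0.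
rewrite ler_norml; lra.
Qed.

Lemma covering_dim_theta_full : linear_span (theta q) = [set: X] ->
  covering_dim R (asym_space q) = 0%:E.
Proof.
move=> Y; apply/eqP; rewrite eq_le covering_dim_ge0 andbT.
have [p p0 pY] := theta_core.
apply: (@covering_dim_le R _ 0) => I U [oU cU].
have /choice[f fU] : forall n : nat, exists i, U i (- (n%:R *: p)).
  move=> n; have : cover setT U (- (n%:R *: p)) by rewrite cU.
  by case=> i _; exists i.
have [i iinf] := infinite_pigeonhole f.
have Ui x : U i x.
  have [N xN] : exists N : nat, theta q ((x : X) + N%:R *: p).
    by apply: pY; rewrite Y.
  have [n Nn fn] := iinf N.
  have := fU n; rewrite fn => /(asym_open_theta (oU i)); apply.
  rewrite opprK -(subnKC Nn) natrD scalerDl addrA.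
  by apply: thetaD => //; apply: thetaZ.
exists unit, (fun=> setT); split.
- split=> [_|]; first exact: openT.
  by apply/seteqP; split=> // x _; exists tt.
- by move=> _; exists i => x _.
- by apply: (cover_order_le (c := fun=> ord0)) => -[] [].
Qed.

End AsymNorm.

(** * Lines through points of a tower of compact sets *)

Section Tower.
Context {R : realType}.

(** A filter that does not cluster at 0 has a member missing a neighbourhood of 0, outside which
    only finitely many terms remain. *)
Lemma inv_seq_compact (c : R) :
  compact ([set 0] `|` range (fun m : nat => c / m.+1%:R)).
Proof.
move=> F PF FS; have [|] := pselect (cluster F 0).
  by move=> ?; exists 0; split=> //; left.
move=> nF0; have [A [B [FA B0 AB0]]] :
    exists A B, [/\ F A, nbhs (0 : R) B & ~ (A `&` B !=set0)].
  apply: contrapT => H; apply: nF0 => A B FA B0; apply: contrapT => AB.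
  by apply: H; exists A, B.
have /nbhs_ballP[e /= e0 eB] := B0.
pose M := Num.bound (`|c| / e).
have cM : compact ((fun m : nat => c / m.+1%:R) @` `I_M).
  by apply/finite_compact/finite_image.
have [] := cM F PF; last first.
  by move=> x [[m _ <-] xF]; exists (c / m.+1%:R); split=> //; right; exists m.
near=> x.
have [Ax [x0|[m _ xm]]] : A x /\ ([set 0] `|` range (fun m : nat => c / m.+1%:R)) x.
- by split; near: x.
- by exfalso; apply: AB0; exists x; split=> //; rewrite x0; apply/eB/ballxx.
exists m => //=; rewrite ltnNge; apply/negP => Mm; apply: AB0.
exists x; split=> //; apply: eB; rewrite -xm.
rewrite -ball_normE /ball_ /= sub0r normrN normrM normfV (@ger0_norm _ m.+1%:R)//.
rewrite ltr_pdivrMr// mulrC -ltr_pdivrMr//.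
apply: (@lt_le_trans _ _ M%:R); last by rewrite ler_nat ltnW.
by apply: archi_boundP; rewrite divr_ge0// ltW.
Unshelve. all: by end_near. Qed.

Lemma uncountable_compl (A : set R) : countable A -> exists c, ~ A c.
Proof.
move=> cA; apply: contrapT => /forallNP H.
have : countable `[0, 1 : R]%classic.
  by apply: sub_countable cA; apply: subset_card_le => x _; apply: contrapT.
move=> /countable_lebesgue_measure0; rewrite lebesgue_measure_itv /= lte_fin ltr01.
by rewrite oppr0 adde0 => /eqP; rewrite eqe oner_eq0.
Qed.

(** To each point [t] of [K] add the sequence t + c / (m + 1). It stays outside [K] if [c] avoids
    the countably many numbers (s - t) (m + 1) with [s] and [t] in [K]; this is why countability is
    carried along. *)
Lemma tower_step (K : set R) : compact K -> countable K -> K !=set0 ->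
  exists K' : set R, [/\ compact K', countable K', K `<=` K' &
    forall t e, K t -> 0 < e -> exists2 t', (K' `\` K) t' & `|t' - t| < e].
Proof.
move=> cK nK [t0 Kt0].
pose bad := (fun x : (R * R) * nat => (x.1.1 - x.1.2) * x.2.+1%:R)
  @` ((K `*` K) `*` setT).
have [c cbad] : exists c, ~ bad c.
  apply: uncountable_compl; apply: sub_countable (card_image_le _ _) _.
  by apply: countableX => //; apply: countableX.
exists ((fun x : R * R => x.1 + x.2) @`
  (K `*` ([set 0] `|` range (fun m : nat => c / m.+1%:R)))); split.
- apply: continuous_compact; last first.
    by apply: compact_setX => //; apply: inv_seq_compact.
  by apply: continuous_subspaceT => x; apply: add_continuous.
- apply: sub_countable (card_image_le _ _) _; apply: countableX => //.
  rewrite -bigcup2E; apply: bigcup_countable => // -[|[|?]] _ //=.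
  exact: sub_countable (card_image_le _ _) _.
- by move=> t Kt; exists (t, 0); [split=> //; left|rewrite /= addr0].
move=> t e Kt e0; pose m := Num.bound (`|c| / e).
exists (t + c / m.+1%:R); last first.
  rewrite addrC addKr normrM normfV (@ger0_norm _ m.+1%:R)//.
  rewrite ltr_pdivrMr// mulrC -ltr_pdivrMr//.
  apply: (@lt_le_trans _ _ m%:R); last by rewrite ler_nat.
  by apply: archi_boundP; rewrite divr_ge0// ltW.
split; first by exists (t, c / m.+1%:R) => //; split=> //; right; exists m.
move=> Kt'; apply: cbad; exists ((t + c / m.+1%:R, t), m) => //=.
by rewrite addrC addKr divfK.
Qed.

Lemma compact_tower : exists K : nat -> set R,
  [/\ K 0%N = set0, K 1%N !=set0, forall k, compact (K k),
      forall k l, (k <= l)%N -> K k `<=` K l &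
      forall k t e, K k t -> 0 < e ->
        exists2 t', (K k.+1 `\` K k) t' & `|t' - t| < e].
Proof.
pose good (K : set R) := [/\ compact K, countable K & K !=set0].
have step (K : {K | good K}) : {K' : {K | good K} | sval K `<=` sval K' /\
    forall t e, sval K t -> 0 < e ->
      exists2 t', (sval K' `\` sval K) t' & `|t' - t| < e}.
  case: K => K gK /=; have [cK nK K0] := gK; apply/cid.
  have [K' [cK' nK' KK' H]] := tower_step cK nK K0.
  have gK' : good K' by split=> //; apply: subset_nonempty K0.
  by exists (exist _ K' gK').
have g1 : good [set 0].
  by split; [exact: compact_set1 | exact: countable1 | exists 0].
(* The levels are shifted by one: [K 0] is empty and [K 1] is the singleton of 0. *)
pose f := fix f n := if n is m.+1 then sval (step (f m)) else exist _ _ g1.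
pose K n := if n is m.+1 then sval (f m) else set0.
have KS k : K k `<=` K k.+1.
  by case: k => [|k] //=; case: (svalP (step (f k))).
exists K; split => //.
- by exists 0.
- by move=> [|k]; [exact: compact0|case: (svalP (f k))].
- by move=> k; elim=> [|l IH]; rewrite leq_eqVlt => /orP[/eqP->//|] //;
    rewrite ltnS => /IH kl x /kl/KS.
move=> [|k] t e //= Kt e0; case: (svalP (step (f k))) => _; exact.
Qed.

End Tower.

Lemma lipschitz_cst_continuous (R : realType) (V : normedModType R) (f : V -> R)
    (C : R) : (forall x y, f x - f y <= C * `|x - y|) -> continuous f.
Proof.
move=> fC x; have C0 : 0 < `|C| + 1 by rewrite ltr_wpDl.
apply/cvgrPdist_lt => e e0; near=> y.
have : `|x - y| < e / (`|C| + 1).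
  near: y; apply: (@cvgr_dist_lt _ _ _ (nbhs x) _ id x) => //.
  by rewrite divr_gt0.
rewrite ltr_pdivlMr// mulrC => xy.
have := fC x y; have := fC y x; rewrite (distrC y x).
have : C * `|x - y| <= `|C| * `|x - y|.
  by rewrite ler_wpM2r // ler_norm.
have := normr_ge0 (x - y); rewrite ltr_norml; lra.
Unshelve. all: by end_near. Qed.

Section LinearSpan.
Context {R : realType} {X : vectType R}.
Implicit Type A : set X.

Lemma linear_span_sub A : A `<=` linear_span A.
Proof.
move=> x Ax; exists [:: x]; last by rewrite memv_span ?mem_head.
by move=> y /=; rewrite inE => /eqP ->.
Qed.

Lemma linear_spanD A x y : linear_span A x -> linear_span A y ->
  linear_span A (x + y).
Proof.
move=> [s sA xs] [s' sA' ys]; exists (s ++ s').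
  by move=> z /=; rewrite mem_cat => /orP[/sA|/sA'].
by rewrite span_cat memv_add.
Qed.

Lemma linear_spanZ A a x : linear_span A x -> linear_span A (a *: x).
Proof. by move=> [s sA xs]; exists s => //; rewrite memvZ. Qed.

End LinearSpan.

(** * The case of a proper nonzero span *)

Section Lines.
Context {R : realType} {X : vectType R} (q : asymNorm X).

Lemma asym_norm_line (a : R) (w : X) : q (a *: w) <= (q w + q (- w)) * `|a|.
Proof.
have [a0|a0] := leP 0 a.
  by rewrite asym_normZ // ger0_norm // [leLHS]mulrC ler_wpM2r // lerDl asym_norm_ge0.
have {1}-> : a *: w = (- a) *: (- w) by rewrite scalerN scaleNr opprK.
have a0' : 0 <= - a by rewrite oppr_ge0 ltW.
rewrite asym_normZ // ltr0_norm // [leLHS]mulrC ler_wpM2r //.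
by rewrite lerDr asym_norm_ge0.
Qed.

Lemma asym_normB_le (x y : X) : q x - q y <= q (x - y).
Proof. by rewrite lerBlDr -{1}(subrK y x) asym_normD. Qed.

Lemma theta_mono (x p : X) : theta q p -> q (x + p) <= q x.
Proof. by move=> p0; rewrite (le_trans (asym_normD _ _ _))// p0 addr0. Qed.

Lemma line_continuous (w z : X) : continuous (fun t : R => q (t *: w - z)).
Proof.
apply: (@lipschitz_cst_continuous _ _ _ (q w + q (- w))) => t s.
apply: le_trans (asym_normB_le _ _) _.
by rewrite opprB addrA subrK -scalerBl asym_norm_line.
Qed.

(** By compactness q (t w - z) has a positive minimum over [K], the radius of a ball around [z]
    inside the set. *)
Lemma compact_line_open (K : set R) (w : X) : compact K ->
  open ([set z : X | forall t, K t -> q (t *: w - z) != 0]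
    : set (asym_space q)).
Proof.
move=> cK; apply/asym_openP => z /= Kz.
have [->|/set0P K0] := eqVneq K set0; first by exists 1 => // y _ t [].
have [|t0 /set_mem Kt0 tmin] := compact_EVT_min (f := fun t : R => q (t *: w - z))
  K0 cK.
  by apply: continuous_subspaceT; apply: line_continuous.
exists (q (t0 *: w - z)); first by rewrite lt_neqAle asym_norm_ge0 eq_sym Kz.
move=> y; rewrite /asym_ball /= => yz t Kt; rewrite gt_eqF //.
have := tmin t (mem_set Kt); have := asym_normB_le (t *: w - z) (t *: w - y).
have -> : t *: w - z - (t *: w - y) = y - z by rewrite opprB addrC addrA subrK.
lra.
Qed.

(* Small enough for the balls around the points [- (N%:R *: p)] to leave out part
   of each ray [s *: w - M%:R *: p] with [s != 0].  A fixed radius would not do: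
   [q (w + a *: p)] may tend to [0] as [a] tends to infinity. *)
Definition line_radius (w p : X) (N : nat) : R :=
  Num.min 1 (Num.min (q (w + (N * N.+1)%:R *: p)) (q (- w + (N * N.+1)%:R *: p))
    / N.+1%:R).

(** If N + 1 < 1 / r, the term - (M - N) p dominates for [M] large and makes [q] at least 1.
    Otherwise |s| is at least 1 / (N + 1): raising the coefficient of [p] to |s| N (N + 1) only
    lowers [q], and homogeneity leaves |s| times a value from [line_radius]. *)
Lemma line_radius_separates (w p : X) (r D : R) : theta q p -> 0 < q (- p) ->
  0 < r -> exists M : nat, forall s, r <= `|s| -> `|s| <= D ->
    forall N : nat, line_radius w p N <= q (s *: w - M%:R *: p + N%:R *: p).
Proof.
move=> p0 p1 r0.
pose C := q w + q (- w).
exists (Num.bound (r^-1 + (1 + C * `|D|) / q (- p))) => s rs sD N.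
set M := Num.bound _.
have C0 : 0 <= C by rewrite addr_ge0 // asym_norm_ge0.
have a0 : 0 <= (1 + C * `|D|) / q (- p).
  by rewrite divr_ge0 // ?addr_ge0 ?mulr_ge0 // ltW.
have MB : r^-1 + (1 + C * `|D|) / q (- p) < M%:R.
  by apply: archi_boundP; rewrite addr_ge0 // invr_ge0 ltW.
have s0 : 0 < `|s| by apply: lt_le_trans rs.
have [Nr|rN] := ltP (N.+1%:R) (r^-1).
  apply: (@le_trans _ _ 1); first by rewrite ge_min lexx.
  have NM : (1 + C * `|D|) / q (- p) <= M%:R - N%:R.
    move: Nr; rewrite -natr1 => Nr.
    have : (N%:R : R) + 1 < r^-1 by []. 
    lra.
  have := asym_normB_le ((M%:R - N%:R) *: - p) (s *: - w).
  rewrite asym_normZ; last by apply: le_trans NM.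
  rewrite ler_pdivrMr // in NM.
  have -> : (M%:R - N%:R) *: - p - s *: - w = s *: w - M%:R *: p + N%:R *: p.
    by rewrite !scalerN opprK scalerBl opprB addrC addrA addrAC.
  have := asym_norm_line s (- w); rewrite opprK (addrC (q (- w))).
  have : C * `|s| <= C * `|D|.
    by rewrite ler_wpM2l // (le_trans sD) // ler_norm.
  rewrite -/C; lra.
have sN : N.+1%:R^-1 <= `|s|.
  apply: le_trans rs; rewrite -[leRHS]invrK lef_pV2 ?posrE ?invr_gt0 //.
pose u : X := if 0 <= s then w else - w.
have su : s *: w = `|s| *: u.
  rewrite /u; case: ifP => [s1|/negbT]; first by rewrite ger0_norm.
  by rewrite -ltNge => s1; rewrite ltr0_norm // scalerN scaleNr opprK.
have qu : Num.min (q (w + (N * N.+1)%:R *: p)) (q (- w + (N * N.+1)%:R *: p)) <=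
    q (u + (N * N.+1)%:R *: p).
  by rewrite /u; case: ifP => _; rewrite ge_min lexx ?orbT.
apply: (@le_trans _ _ (q (u + (N * N.+1)%:R *: p) / N.+1%:R)).
  by rewrite ge_min ler_wpM2r ?invr_ge0 // orbT.
apply: (@le_trans _ _ (`|s| * q (u + (N * N.+1)%:R *: p))).
  by rewrite mulrC ler_wpM2r ?asym_norm_ge0.
rewrite -asym_normZ // scalerDr -su scalerA addrAC -addrA.
set a := _ * _%:R.
have -> : s *: w + a *: p =
    s *: w + (N%:R *: p - M%:R *: p) + (a - N%:R + M%:R) *: p.
  by rewrite -addrA -scalerBl -scalerDl; congr (_ + _ *: _); ring.
apply: theta_mono; apply: thetaZ => //.
have : N%:R <= a.
  rewrite /a natrM mulrCA ler_peMr // -ler_pdivrMr // div1r //.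
have : 0 <= (M%:R : R) by [].
lra.
Qed.


(* If finitely many members of [V] meet at any point, then only finitely many
   contain some [z - k%:R *: p], since all of these contain [z]; so one of them
   contains arbitrarily low points of the ray, hence the whole ray. *)
Lemma cover_line (J : Type) (V : J -> set (asym_space q)) (n : nat) (p z : X) :
  theta q p -> open_cover V ->
  (forall (f : 'I_n.+1 -> J) x, injective f -> ~ forall i, V (f i) x) ->
  exists j, forall k, V j (z - k%:R *: p).
Proof.
move=> p0 [oV cV] Vn; apply: contrapT => /forallNP H.
have /choice[g gV] : forall j, exists k, ~ V j (z - k%:R *: p).
  by move=> j; apply/existsNP.
have /choice[h hV] : forall k : nat, exists j, V j (z - k%:R *: p).
  move=> k; have : cover setT V (z - k%:R *: p) by rewrite cV.
  by case=> j _; exists j.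
have Vmono j k l : (k <= l)%N -> V j (z - l%:R *: p) -> V j (z - k%:R *: p).
  move=> kl /(asym_open_theta (oV j)); apply.
  have -> : z - k%:R *: p - (z - l%:R *: p) = (l - k)%:R *: p.
    by rewrite natrB // scalerBl opprB addrC addrA subrK.
  exact: thetaZ.
(* [m] jumps to the depth at which the current member has lost the ray, so a member once chosen
   never recurs. *)
pose m := fix m i := if i is i'.+1 then maxn (m i') (g (h (m i'))) else 0%N.
have mS i : (m i <= m i.+1)%N by rewrite /= leq_maxl.
have m_mono i i' : (i < i')%N -> (g (h (m i)) <= m i')%N.
  elim: i' => // i' IH; rewrite ltnS leq_eqVlt => /orP[/eqP <-|/IH ii'].
    by rewrite /= leq_maxr.
  exact: leq_trans ii' (mS i').
have m_neq i i' : (i < i')%N -> h (m i) <> h (m i').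
  move=> /m_mono gm E; apply: (gV (h (m i))); apply: Vmono gm _.
  by rewrite E.
apply: (Vn (fun i => h (m i)) z).
  move=> i i' E; apply/val_inj; case: (ltngtP i i') => // /m_neq; first by case.
  by move=> /(_ (esym E)).
by move=> i; have := Vmono _ 0%N _ (leq0n _) (hV (m i)); rewrite scale0r subr0.
Qed.

Lemma covering_dim_proper_ge (n : nat) :
  linear_span (theta q) <> [set 0] -> linear_span (theta q) <> [set: X] ->
  (n%:R%:E <= covering_dim R (asym_space q))%E.
Proof.
move=> Y0 YT; have [p p0 pY] := theta_core q.
have spanN x : linear_span (theta q) x -> linear_span (theta q) (- x).
  by rewrite -scaleN1r; apply: linear_spanZ.
have p1 : 0 < q (- p).
  rewrite lt_neqAle asym_norm_ge0 andbT eq_sym; apply/eqP => p1.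
  have pe := asym_norm_eq0 p0 p1; apply: Y0.
  apply/seteqP; split=> [x xY|_ ->]; last first.
    by apply: linear_span_sub; apply: asym_norm0.
  have [N] := pY x xY; have [N'] := pY _ (spanN _ xY).
  by rewrite pe !scaler0 !addr0 => ? ?; apply: (asym_norm_eq0 (a0 := q)).
have [w wY] : exists w, ~ linear_span (theta q) w.
  by apply/existsNP => H; apply: YT; apply/seteqP; split=> // x _; apply: H.
have w_inj s t : linear_span (theta q) ((s - t) *: w) -> s = t.
  move=> stY; apply/eqP; rewrite -subr_eq0; apply/negP => /negP st.
  by apply: wY; rewrite -(scalerK st w); apply: linear_spanZ.
have r_gt0 N : 0 < line_radius w p N.
  have spanp a : linear_span (theta q) (a *: p).
    by apply: linear_spanZ; apply: linear_span_sub.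
  have q0 x y : linear_span (theta q) y -> ~ linear_span (theta q) x ->
      0 < q (x + y).
    move=> yY xY; rewrite lt_neqAle asym_norm_ge0 andbT eq_sym.
    apply/eqP => xy; apply: xY; rewrite -(addrK y x).
    by apply: linear_spanD; [exact: linear_span_sub|exact: spanN].
  rewrite lt_min ltr01 /= divr_gt0 // lt_min !q0 //.
  by move=> /spanN; rewrite opprK.
have [K [K0 K1 cK KS Kdense]] := @compact_tower R.
(* [E k] leaves out the points from which [theta q] leads to some t w with [t] in [K k]; [B k]
   surrounds the points t w - N p by balls of the separating radii. *)
pose E k : set X := [set z | forall t, K k t -> q (t *: w - z) != 0].
pose B k : set X := [set z | exists t N, K k t /\
  q (z - (t *: w - N%:R *: p)) < line_radius w p N].
(* [U i] is meant for level [i]: [B i.+1] keeps it near the lines of levels up to [i], [E i] off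
   those of lower levels. The last member takes all levels from n on. *)
pose U (i : 'I_n.+1) : set (asym_space q) :=
  if i == n :> nat then E n else B i.+1 `&` E i.
have oE k : open (E k : set (asym_space q)) by apply: compact_line_open.
have oB k : open (B k : set (asym_space q)).
  apply/asym_openP => z [t [N [Kt tz]]].
  exists (line_radius w p N - q (z - (t *: w - N%:R *: p))); rewrite ?subr_gt0//.
  move=> y; rewrite /asym_ball /= ltrBrDr => yz; exists t, N; split=> //.
  by apply: le_lt_trans yz; rewrite -[leLHS](congr1 q (subrKA z _ _)) asym_normD.
have UE (i : 'I_n.+1) : U i `<=` E i.
  by rewrite /U; case: eqP => [-> //|_]; apply: subIsetr.
have UB (i : 'I_n.+1) : (i < n)%N -> U i `<=` B i.+1.
  by move=> i_n; rewrite /U ltn_eqF //; apply: subIsetl.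
have cU : open_cover U.
  split=> [i|]; first by rewrite /U; case: ifP => _ //; apply: openI.
  apply/seteqP; split=> // z _.
  have [Ez|] := pselect (E n z); first by exists ord_max; rewrite // /U eqxx.
  move=> /existsNP[t /not_implyP[Kt /negP/negPn/eqP tz]].
  have exK : exists k, `[< K k t >] by exists n; apply/asboolP.
  (* [K 0] is empty, so the least index of a [K] containing [t] is a successor; its predecessor is
     the level of [t]. *)
  case: (ex_minnP exK) => -[|k] /asboolP Kkt kmin; first by rewrite K0 in Kkt.
  have kn : (k < n)%N by apply: kmin; apply/asboolP.
  exists (Ordinal (ltnW kn : (k < n.+1)%N)) => //; rewrite /U /= ltn_eqF //.
  split.
    have [N Nz] : exists N : nat, theta q (- (t *: w - (z : X)) + N%:R *: p).
      by apply: pY; apply: spanN; apply: linear_span_sub.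
    exists t, N; split=> //; suff -> : q (z - (t *: w - N%:R *: p)) = 0 by [].
    by move: Nz; rewrite !opprB addrA addrAC.
  move=> s Ks; apply/eqP => sz.
  suff st : s = t.
    have := kmin k; rewrite ltnn => /(_ _)/negP; apply => //.
    by apply/asboolP; rewrite -st.
  apply: w_inj; have -> : (s - t) *: w = (s *: w - (z : X)) - (t *: w - z).
    by rewrite opprB addrA subrK scalerBl.
  by apply: linear_spanD; [|apply: spanN]; apply: linear_span_sub.
pose lvl k t := K k.+1 t /\ ~ K k t.
(* For a lower [i], [t] is at positive bounded distance from the compact [K i.+1], so some point of
   the line escapes [B i.+1]. For a higher [i], t w itself is not in [E i]. *)
have lvlU k t (i : 'I_n.+1) : (k <= n)%N -> lvl k t ->
    (forall M, U i (t *: w - M%:R *: p)) -> i = k :> nat.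
  move=> kn [Kt nKt] Ut; case: (ltngtP i k) => // ik.
    have i_n : (i < n)%N by apply: leq_trans ik kn.
    have nKit s : K i.+1 s -> 0 < `|t - s|.
      move=> Ks; rewrite normr_gt0 subr_eq0; apply/eqP => ts.
      by apply: nKt; rewrite ts; apply: KS Ks.
    have Ki : K i.+1 !=set0 by apply: subset_nonempty K1; apply: KS.
    have ct : continuous (fun s : R => `|t - s|).
      apply: (@lipschitz_cst_continuous _ _ _ 1) => s s'.
      by have := ler_distD s' t s; rewrite (distrC s') mul1r; lra.
    have [s0 /set_mem Ks0 s0min] :=
      compact_EVT_min Ki (cK _) (continuous_subspaceT ct).
    have [s1 _ s1max] :=
      compact_EVT_max Ki (cK _) (continuous_subspaceT ct).
    have [M HM] := line_radius_separates w `|t - s1| p0 p1 (nKit _ Ks0).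
    have [s [N [Ks]]] := UB i i_n _ (Ut M); rewrite ltNge => /negP[].
    have -> : t *: w - M%:R *: p - (s *: w - N%:R *: p) =
        (t - s) *: w - M%:R *: p + N%:R *: p.
      by rewrite opprB addrA addrAC; congr (_ + _); rewrite scalerBl addrAC.
    exact: HM (s0min s (mem_set Ks)) (s1max s (mem_set Ks)) N.
  have Kit : K i t by apply: KS Kt.
  have := UE i _ (Ut 0%N) t Kit.
  by rewrite scale0r subr0 subrr asym_norm0 eqxx.
apply: (covering_dim_ge cU) => J V cV VU; rewrite leNgt; apply/negP => Vn.
have noinj (f : 'I_n.+1 -> J) x : injective f -> ~ forall i, V (f i) x.
  by move=> f_inj /(cover_order_ge f_inj) => /(_ R); rewrite leNgt Vn.
have /choice[j jV] : forall t : R, exists j, forall M, V j (t *: w - M%:R *: p).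
  by move=> t; apply: (cover_line _ p0 cV noinj).
have jU k t i : (k <= n)%N -> lvl k t -> V (j t) `<=` U i -> i = k :> nat.
  by move=> kn tk VUi; apply: (lvlU k t i kn tk) => M; apply/VUi.
(* [W] is a common neighbourhood inside all members chosen so far; the next real is so close that
   its point stays in [W]. *)
have chain k : (k <= n)%N -> exists t (W : set (asym_space q)) (g : nat -> R),
    [/\ lvl k t, open W, W (t *: w) & forall i, (i <= k)%N ->
      lvl i (g i) /\ W `<=` V (j (g i))].
  have Vj t : V (j t) (t *: w) by have := jV t 0%N; rewrite scale0r subr0.
  elim: k => [_|k IH kn].
    have [t Kt] := K1.
    exists t, (V (j t)), (fun=> t); split=> //.
    - by split; rewrite ?K0.
    - exact: cV.1.
    - by move=> i; rewrite leqn0 => /eqP ->; split=> //; split; rewrite ?K0.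
  have [t [W [g [ [tK _] oW Wt gP]]]] := IH (ltnW kn).
  have /asym_openP/(_ _ Wt)[e e0 eW] := oW.
  pose C := q w + q (- w).
  have C0 : 0 < C + 1 by rewrite ltr_wpDl // addr_ge0 // asym_norm_ge0.
  have [t' t'K tt'] := Kdense _ t _ tK (divr_gt0 e0 C0).
  exists t', (W `&` V (j t')), (fun i => if i == k.+1 then t' else g i); split=> //.
  - by apply: openI => //; apply: cV.1.
  - split=> //; apply: eW; rewrite /asym_ball /= -scalerBl.
    apply: le_lt_trans (asym_norm_line _ _) _; rewrite -/C.
    move: tt'; rewrite ltr_pdivlMr // mulrC; apply: le_lt_trans.
    by rewrite ler_wpM2r // lerDl.
  - move=> i; rewrite leq_eqVlt; case: eqP => [-> _|_]; first by split.
    by rewrite /= ltnS => /gP[lg Wg]; split=> // x [/Wg].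
have [t [W [g [_ _ Wt gP]]]] := chain n (leqnn n).
apply: (noinj (fun i => j (g i)) (t *: w)); last first.
  by move=> i; apply: (gP i _).2; rewrite // -ltnS.
(* A member lies in some [U u], whose index must be the level, so different levels give different
   members. *)
move=> i i' ii'; have [u Vu] := VU (j (g i)); apply/val_inj.
have le_n (k : 'I_n.+1) : (k <= n)%N by rewrite -ltnS.
have := jU i (g i) u (le_n i) (gP i (le_n i)).1 Vu.
have -> // := jU i' (g i') u (le_n i') (gP i' (le_n i')).1.
by rewrite -ii'.
Qed.

Lemma covering_dim_proper :
  linear_span (theta q) <> [set 0] -> linear_span (theta q) <> [set: X] ->
  covering_dim R (asym_space q) = +oo%E.
Proof.
move=> Y0 YT; apply/eqyP => A A0.
apply: le_trans (covering_dim_proper_ge (Num.bound A) Y0 YT).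
by rewrite lee_fin ltW // archi_boundP // ltW.
Qed.

End Lines.

(** * The dimension of R^n *)

Section Homeo.
Context {R : realType} (T T' : topologicalType).

Lemma covering_dim_homeo_le (f : T -> T') (g : T' -> T) :
  continuous f -> continuous g -> cancel f g -> cancel g f ->
  (covering_dim R T <= covering_dim R T')%E.
Proof.
move=> /continuousP cf /continuousP cg fK gK.
apply: ereal_inf_le_tmp => _ [n Hn <-]; exists n => // I U [oU cU].
have [|J [V [V0 [oV cV] VU Vn]]] := Hn I (fun i => g @^-1` U i).
  split=> [i|]; first exact: cg.
  apply/seteqP; split=> // x _.
  have [i _ Ui] : cover setT U (g x) by rewrite cU.
  by exists i.
exists J, (fun j => f @^-1` V j); split.
- by move=> j; have [y Vy] := V0 j; exists (g y); rewrite /preimage /= gK.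
- split=> [j|]; first exact: cf.
  apply/seteqP; split=> // x _.
  have [j _ Vj] : cover setT V (f x) by rewrite cV.
  by exists j.
- by move=> j; have [i Vi] := VU j; exists i => x /Vi; rewrite /preimage /= fK.
apply: le_trans Vn; apply: ereal_sup_le => _ [m [M [Mm [x xM]]] <-].
exists m => //; exists M; split=> //.
by exists (f x).
Qed.

End Homeo.

Lemma open_forall (T : topologicalType) (I : finType) (A : I -> set T) :
  (forall i, open (A i)) -> open [set x | forall i, A i x].
Proof.
move=> oA; rewrite openE => x /= Ax; apply: filter_forall => i.
exact: open_nbhs_nbhs.
Qed.

(** * Upper bound for R^n by bricks *)

Section RowSpace.
Context {R : realType} (n : nat).
Local Notation V := 'rV[R]_n.

Lemma rV_norm_coord (u : V) i : `|u 0 i| <= `|u|.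
Proof.
rewrite [leRHS]mx_normrE.
by apply/bigmax_geP; right; exists (0, i).
Qed.

Lemma rV_norm_lt (u : V) e : 0 < e -> (forall i, `|u 0 i| < e) -> `|u| < e.
Proof.
move=> e0 ue; rewrite [ltLHS]mx_normrE; apply/bigmax_ltP; split=> //.
by move=> [i j] _; rewrite ord1; apply: ue.
Qed.

Lemma open_coord_gt (a : R) (i : 'I_n) : open [set u : V | a < u 0 i].
Proof.
apply: (@open_comp _ _ (fun u : V => u 0 i) [set x | a < x]).
  by move=> u _; apply: coord_continuous.
exact: open_gt.
Qed.

Lemma open_coord_lt (a : R) (i : 'I_n) : open [set u : V | u 0 i < a].
Proof.
apply: (@open_comp _ _ (fun u : V => u 0 i) [set x | x < a]).
  by move=> u _; apply: coord_continuous.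
exact: open_lt.
Qed.

Lemma open_ballP (U : set V) u : open U -> U u ->
  exists2 e, 0 < e & forall v, `|v - u| < e -> U v.
Proof.
rewrite openE => oU /oU /nbhs_ballP[e /= e0 eU]; exists e => // v vu.
by apply: eU; rewrite -ball_normE /ball_ /= distrC.
Qed.

Lemma exists_irrational : exists c : R, ~ range (@ratr R) c.
Proof.
apply: uncountable_compl; apply: sub_countable (card_image_le _ _) _.
exact: countableP.
Qed.

Section Bricks.
(* Irrationality makes the grids [k%:R * c + rat], for [k <= n], disjoint. *)
Variable c : R.
Hypothesis c_irr : ~ range (@ratr R) c.

Definition brick (k : 'I_n.+1) (b : {ffun 'I_n -> rat * rat}) : set V :=
  [set u | forall i, k%:R * c + ratr (b i).1 < u 0 i /\
                     u 0 i < k%:R * c + ratr (b i).2].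

Definition closed_brick (k : 'I_n.+1) (b : {ffun 'I_n -> rat * rat}) : set V :=
  [set u | forall i, k%:R * c + ratr (b i).1 <= u 0 i /\
                     u 0 i <= k%:R * c + ratr (b i).2].

Lemma brick_open k b : open (brick k b).
Proof.
apply: open_forall => i.
by apply: openI; [exact: open_coord_gt|exact: open_coord_lt].
Qed.

Lemma closed_brick_open k b : open (~` closed_brick k b).
Proof.
rewrite (_ : ~` _ = \bigcup_(i in setT)
  ([set u : V | u 0 i < k%:R * c + ratr (b i).1] `|`
   [set u : V | k%:R * c + ratr (b i).2 < u 0 i])).
  apply: bigcup_open => i _.
  by apply: openU; [exact: open_coord_lt|exact: open_coord_gt].
apply/seteqP; split=> u.
  move=> /existsNP[i ui]; exists i => //.
  have [u1|u1] := ltP (u 0 i) (k%:R * c + ratr (b i).1); first by left.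
  by right => /=; rewrite ltNge; apply/negP => u2; apply: ui.
by move=> [i _ H] /(_ i)[u1 u2]; case: H => /=; rewrite ltNge ?u1 ?u2.
Qed.

(** Pigeonhole: otherwise one coordinate lies on two of the n + 1 grids, and a nonzero integer
    multiple of [c] is rational. *)
Lemma avoid_grid (u : V) : exists k : 'I_n.+1,
  forall i r, u 0 i <> k%:R * c + ratr r.
Proof.
apply: contrapT => /forallNP H.
have /choice[f fP] : forall k : 'I_n.+1, exists ir : 'I_n * rat,
    u 0 ir.1 = k%:R * c + ratr ir.2.
  move=> k; have /existsNP[i /existsNP[r /contrapT ur]] := H k.
  by exists (i, r).
have /injectivePn[k [k' kk' fk]] : ~~ injectiveb (fun k => (f k).1).
  apply/injectiveP => /leq_card; rewrite !card_ord ltnn //.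
apply: c_irr; exists (((f k').2 - (f k).2) / (k%:R - k'%:R)) => //.
have kk0 : (k%:R - k'%:R : R) != 0.
  by rewrite subr_eq0 eqr_nat; apply: contra kk' => /eqP/val_inj->.
rewrite fmorph_div !rmorphB /= !ratr_nat.
apply/(mulIf kk0); rewrite divfK //.
have := fP k; have := fP k'; rewrite fk => ->; lra.
Qed.

Lemma brick_nbhs (U : set V) (k : 'I_n.+1) u : open U -> U u ->
  exists2 b, brick k b `<=` U & brick k b u.
Proof.
move=> oU /(open_ballP oU)[e e0 eU].
have /choice[b bP] : forall i, exists r : rat * rat,
    [/\ u 0 i - e < k%:R * c + ratr r.1, k%:R * c + ratr r.1 < u 0 i,
        u 0 i < k%:R * c + ratr r.2 & k%:R * c + ratr r.2 < u 0 i + e].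
  move=> i.
  pose a := u 0 i - k%:R * c.
  have [|r1] := @rat_in_itvoo R (a - e) a; first lra.
  have [|r2] := @rat_in_itvoo R a (a + e); first lra.
  rewrite /a !in_itv /= => /andP[? ?] /andP[? ?]; exists (r1, r2); split=> /=; lra.
exists [ffun i => b i].
  move=> v vb; apply: eU; apply: rV_norm_lt => // i; rewrite !mxE ltr_norml.
  have := vb i; have := bP i; rewrite ffunE => -[? ? ? ?] [? ?]; lra.
by move=> i; rewrite ffunE; have [] := bP i.
Qed.

(** Number the good bricks of each grid by [pickle] and remove from each the closures of its
    predecessors. Those of one grid become disjoint, and only points on the walls of that grid are
    lost; the grid is the colour for [cover_order_le]. *)
Lemma covering_dim_rV_le : (covering_dim R V <= n%:R%:E)%E.
Proof.
apply: covering_dim_le => I U [oU cU].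
pose good k b := exists i, brick k b `<=` U i.
pose W (kb : 'I_n.+1 * {ffun 'I_n -> rat * rat}) : set V :=
  [set u | [/\ good kb.1 kb.2, brick kb.1 kb.2 u &
    forall b', (pickle b' < pickle kb.2)%N -> good kb.1 b' ->
      ~ closed_brick kb.1 b' u]].
have brickS k b : brick k b `<=` closed_brick k b.
  by move=> u ub i; have [] := ub i; split; apply: ltW.
exists ('I_n.+1 * {ffun 'I_n -> rat * rat})%type, W; split.
- split=> [[k b]|].
    have [gb|gb] := pselect (good k b); last first.
      rewrite (_ : W _ = set0); first exact: open0.
      by apply/seteqP; split=> // u [].
    pose C (j : 'I_(pickle b)) : set V := [set u | forall b', pickle b' = j ->
      good k b' -> ~ closed_brick k b' u].
    rewrite (_ : W _ = brick k b `&` [set u | forall j, C j u]); last first.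
      apply/seteqP; split=> [u [_ ub H]|u [ub H]]; split=> //.
        by move=> j b' b'j; apply: H; rewrite b'j.
      by move=> b' b'b; apply: (H (Ordinal b'b)).
    apply: openI; first exact: brick_open.
    apply: open_forall => j.
    have [[b' [b'j gb']]|nb] := pselect (exists b', pickle b' = j /\ good k b').
      rewrite (_ : C j = ~` closed_brick k b'); first exact: closed_brick_open.
      apply/seteqP; split=> [u /(_ b' b'j gb')//|u ub' b'' b''j _].
      by rewrite (pcan_inj pickleK (etrans b''j (esym b'j))).
    rewrite (_ : C j = setT); first exact: openT.
    by apply/seteqP; split=> // u _ b' b'j gb'; case: nb; exists b'.
  apply/seteqP; split=> // u _.
  have [k uk] := avoid_grid u.
  have : cover setT U u by rewrite cU.
  case=> i _ Ui; have [b bU ub] := brick_nbhs k (oU i) Ui.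
  have exP : exists m, `[< exists b, [/\ pickle b = m, good k b & brick k b u] >].
    by exists (pickle b); apply/asboolP; exists b; split=> //; exists i.
  case: (ex_minnP exP) => m /asboolP[b1 [b1m gb1 ub1]] mmin.
  (* [u] is off the walls, so an earlier closed brick around it would be an earlier open one. *)
  exists (k, b1) => //; split=> //= b2 b21 gb2 ub2.
  suff : (m <= pickle b2)%N by rewrite leqNgt -b1m b21.
  apply: mmin; apply/asboolP; exists b2; split=> // j.
  have [u1 u2] := ub2 j; rewrite !lt_neqAle u1 u2 !andbT.
  by split; apply/eqP => E; apply: (uk j _); [symmetry; exact: E|exact: E].
- have [i _ _] : cover setT U 0 by rewrite cU.
  move=> [k b]; have [[i' bU]|gb] := pselect (good k b).
    by exists i' => u [_ /bU].
  by exists i => u [].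
apply: (cover_order_le (c := fst)) => -[k b] [k' b'] u /= [gb ub bH] [gb' ub' bH'].
move=> /= kk'; rewrite -kk' in gb' ub' bH' *; congr pair.
case: (ltngtP (pickle b) (pickle b')) => [bb'|bb'|/(pcan_inj pickleK) //].
  by case: (bH' _ bb' gb); apply: brickS.
by case: (bH _ bb' gb'); apply: brickS.
Qed.

End Bricks.
End RowSpace.

Lemma open_imply (T : topologicalType) (P : Prop) (A : set T) :
  open A -> open [set x | P -> A x].
Proof.
have [p|np] := pselect P => oA.
  by rewrite (_ : mkset _ = A) //; apply/seteqP; split=> [x /(_ p)|x Ax].
by rewrite (_ : mkset _ = setT); [exact: openT|apply/seteqP; split=> // x _ /np].
Qed.

(** * Lebesgue's covering theorem *)

Section RowSpaceLower.
Context {R : realType} (n : nat).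
Local Notation V := 'rV[R]_n.

Lemma cube_compact :
  compact [set u : V | forall i, `[0, 1 : R]%classic (u ord0 i)].
Proof.
by apply: (@rV_compact R n (fun=> `[0, 1]%classic)) => i; apply: segment_compact.
Qed.

(** Half of the radius available at a point serves all nearby points; compactness in its
    near-covering form makes one radius serve all of [K]. *)
Lemma lebesgue_number (I : Type) (W : I -> set V) (K : set V) : compact K ->
  (forall i, open (W i)) -> (forall u, K u -> exists i, W i u) ->
  exists2 d : R, 0 < d &
    forall u, K u -> exists i, forall v, `|v - u| < d -> W i v.
Proof.
move=> /compact_near_coveringP cK oW KW.
pose P (d : R) (u : V) := exists i, forall v, `|v - u| < d -> W i v.
have : \forall d \near (0 : R)^'+, K `<=` P d.
  apply: (cK R (0 : R)^'+ P) => u /KW[i Wu]; have [e e0 eW] := open_ballP (oW i) Wu.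
  have e2 : 0 < e / 2 by rewrite divr_gt0.
  near=> u' d; exists i => v vu'; apply: eW.
  have u'u : `|u - u'| < e / 2.
    by near: u'; apply: (@cvgr_dist_lt _ _ _ (nbhs u) _ id u).
  have de : d < e / 2 by near: d; apply: nbhs_right_lt.
  apply: le_lt_trans (ler_distD u' v u) _; rewrite (distrC u' u).
  by rewrite [ltRHS]splitr ltrD // (lt_trans vu').
move=> H; near (0 : R)^'+ => d; exists d; first by near: d; apply: nbhs_right_gt.
by near: d.
Unshelve. all: by end_near. Qed.

(* A label [i < n] rules out the face [u 0 i = 1], and every label larger
   than [j] rules out the face [u 0 j = 0], as in Sperner's lemma. *)
Definition face_cover (i : 'I_n.+1) : set V :=
  [set u | forall j : 'I_n, (j = i :> nat -> u 0 j < 1) /\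
                            ((j < i)%N -> 0 < u 0 j)].

(** The label of a point is the index of its first coordinate that is at most 0, and n if there is
    none. *)
Lemma face_cover_open_cover : open_cover face_cover.
Proof.
split=> [i|].
  apply: open_forall => j; apply: openI.
    apply: (@open_imply _ (j = i :> nat) [set u : V | u 0 j < 1]).
    exact: open_coord_lt.
  apply: (@open_imply _ (j < i)%N [set u : V | 0 < u 0 j]).
  exact: open_coord_gt.
apply/seteqP; split=> // u _.
pose P k := [exists j : 'I_n, (j == k :> nat) && (u 0 j <= 0)] || (k == n).
have exP : exists k, P k by exists n; rewrite /P eqxx orbT.
case: (ex_minnP exP) => k Pk kmin.
have kn : (k < n.+1)%N by rewrite ltnS kmin // /P eqxx orbT.
exists (Ordinal kn) => // j; split=> /= jk.
  case/orP: Pk => [/existsP[j' /andP[/eqP j'k uj']]|/eqP kE]; last first.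
    by have := ltn_ord j; rewrite jk kE ltnn.
  have -> : j = j' by apply: val_inj; rewrite /= jk j'k.
  exact: le_lt_trans uj' ltr01.
rewrite ltNge; apply/negP => uj; have := kmin j; rewrite leqNgt jk => /(_ _)/negP.
by apply => //; apply/orP; left; apply/existsP; exists j; rewrite eqxx.
Qed.

(** Merge the refinement by labels into [B], and label each point of a grid finer than a Lebesgue
    number by some [B i] containing the [d]-ball around it. The small cube with all labels then has
    a corner in every [B i], hence in n + 1 distinct members. *)
Lemma covering_dim_rV_ge : (n%:R%:E <= covering_dim R V)%E.
Proof.
apply: (covering_dim_ge face_cover_open_cover) => J W [oW cW] /choice[phi WU].
pose B i := \bigcup_(j in [set j | phi j = i]) W j.
have oB i : open (B i) by apply: bigcup_open => j _; apply: oW.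
have BU i : B i `<=` face_cover i by move=> u [j <-]; apply: WU.
have [|d d0 dB] := lebesgue_number cube_compact oB.
  move=> u _; have [j _ Wu] : cover setT W u by rewrite cW.
  by exists (phi j), j.
pose N := Num.bound d^-1.
have N0 : (0 : R) < N.+1%:R by [].
have Nd : N.+1%:R^-1 < d.
  rewrite -[ltRHS]invrK ltf_pV2 ?posrE ?invr_gt0 //.
  apply: (@lt_trans _ _ N%:R); last by rewrite ltr_nat.
  by apply: archi_boundP; rewrite invr_ge0 ltW.
pose pt (v : {ffun 'I_n -> nat}) : V := \row_i ((v i)%:R / N.+1%:R).
have /choice[F FP] : forall v : {ffun 'I_n -> nat}, exists i : 'I_n.+1,
    (forall i, (v i <= N.+1)%N) -> forall w, `|w - pt v| < d -> B i w.
  move=> v; have [vN|vN] := pselect (forall i, (v i <= N.+1)%N); last by exists ord0.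
  have [|i Bi] := dB (pt v); last by exists i.
  move=> i; rewrite /= in_itv /= mxE divr_ge0 //= ler_pdivrMr // mul1r ler_nat.
  exact: vN.
have FU (v : {ffun 'I_n -> nat}) : (forall i, (v i <= N.+1)%N) ->
    face_cover (F v) (pt v).
  by move=> vN; apply: BU; apply: FP => //; rewrite subrr normr0.
have [||| x xP] := @cube_sperner n N (fun v => F v : nat).
- by move=> v _; rewrite -ltnS.
- move=> v vN i vi Fv; have [/(_ (esym Fv)) + _] := FU v vN i.
  by rewrite mxE vi divff ?ltxx // gt_eqF.
- move=> v vN i vi; rewrite leqNgt; apply/negP => iF.
  by have [_ /(_ iF)] := FU v vN i; rewrite mxE vi mul0r ltxx.
have /choice[g gP] : forall c : 'I_n.+1, exists j, phi j = c /\ W j (pt x).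
  move=> c; have [v [vP Fv]] := xP c (ltn_ord c).
  have [j jc Wj] : B (F v) (pt x).
    apply: FP => [i|]; first by have [] := vP i.
    apply: rV_norm_lt => // i; rewrite !mxE -mulrBl normrM normfV.
    rewrite (@ger0_norm _ N.+1%:R) //.
    apply: le_lt_trans Nd; rewrite ler_piMl ?invr_ge0 //.
    have [/andP[xv vx] _] := vP i.
    rewrite distrC ger0_norm ?subr_ge0 ?ler_nat //.
    by rewrite lerBlDl natr1 ler_nat.
  by exists j; split=> //; rewrite jc; apply: val_inj.
apply: (cover_order_ge (f := g) (x := pt x)); last by move=> c; case: (gP c).
by move=> c c' E; have [<- _] := gP c; have [<- _] := gP c'; rewrite E.
Qed.

Lemma covering_dim_rV : covering_dim R V = n%:R%:E.
Proof.
have [c c_irr] := @exists_irrational R.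
by apply/eqP; rewrite eq_le (covering_dim_rV_le n c_irr) covering_dim_rV_ge.
Qed.

End RowSpaceLower.

(** * Comparison of [q] with the norm of R^n *)

Section NormEquivalence.
Context {R : realType} {X : vectType R} (q : asymNorm X).
Local Notation n := (dim X).

Lemma asym_norm_le_rV : exists2 C : R, 0 < C &
  forall u : 'rV[R]_n, q (r2v u : X) <= C * `|u|.
Proof.
pose e i := r2v (delta_mx 0 i : 'rV[R]_n) : X.
(* The summand 1 keeps the constant positive in dimension 0, where the sum is empty. *)
exists (1 + \sum_(i < n) (q (e i) + q (- e i))).
  by rewrite ltr_wpDr // sumr_ge0 // => i _; rewrite addr_ge0 // asym_norm_ge0.
move=> u; rewrite {1}[u]row_sum_delta linear_sum.
apply: (@le_trans _ _ (\sum_(i < n) q (r2v (u 0 i *: delta_mx 0 i : 'rV_n) : X))).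
  apply: (big_ind2 (fun x y => q x <= y)) => //.
    by rewrite asym_norm0.
  by move=> x y x' y' xy xy'; rewrite (le_trans (asym_normD _ _ _)) // lerD.
rewrite mulrDl mul1r mulr_suml ler_wpDl //; apply: ler_sum => i _.
rewrite linearZ; apply: le_trans (asym_norm_line _ _ _) _.
by rewrite ler_wpM2l ?addr_ge0 ?asym_norm_ge0 // rV_norm_coord.
Qed.

(** [q] has a positive minimum on the unit sphere, since only 0 lies in [theta q]; homogeneity does
    the rest. *)
Lemma asym_norm_ge_rV : theta q = [set 0] ->
  exists2 c : R, 0 < c & forall u : 'rV[R]_n, c * `|u| <= q (r2v u : X).
Proof.
move=> q0; have [C C0 qC] := asym_norm_le_rV.
have cq : continuous (fun u : 'rV[R]_n => q (r2v u : X)).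
  apply: (@lipschitz_cst_continuous _ _ _ C) => u v.
  by apply: le_trans (asym_normB_le _ _ _) _; rewrite -linearB; apply: qC.
pose S := [set u : 'rV[R]_n | `|u| = 1].
have cS : compact S.
  apply: bounded_closed_compact.
    exists 1; split; first exact: num_real.
    by move=> M M1 u; rewrite /S /= => ->; apply: ltW.
  rewrite (_ : S = (fun u : 'rV[R]_n => `|u|) @^-1` [set 1]) //.
  apply: (closed_comp (f := fun u : 'rV[R]_n => `|u|)); last exact: closed_eq.
  by move=> u _; apply: norm_continuous.
have [S0|/set0P S0] := eqVneq S set0.
  exists 1 => // u; have [->|u0] := eqVneq u 0.
    by rewrite normr0 mulr0 asym_norm_ge0.
  have : S (`|u|^-1 *: u).
    by rewrite /S /= normrZ normfV normr_id mulVf // normr_eq0.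
  by rewrite S0.
have [u0 /set_mem Su0 u0min] := compact_EVT_min S0 cS (continuous_subspaceT cq).
exists (q (r2v u0)).
  rewrite lt_neqAle asym_norm_ge0 andbT eq_sym; apply/eqP => qu0.
  have : theta q (r2v u0) by [].
  rewrite q0 => /= u00; have : u0 = 0 by rewrite -[u0]r2vK u00 linear0.
  by move=> E; move: Su0; rewrite /S /= E normr0 => /esym/eqP; rewrite oner_eq0.
move=> u; have [->|un0] := eqVneq u 0.
  by rewrite normr0 mulr0 asym_norm_ge0.
have nu : 0 < `|u| by rewrite normr_gt0.
have := u0min (`|u|^-1 *: u).
rewrite linearZ asym_normZ ?invr_ge0 // mulrC ler_pdivlMr //; apply.
by rewrite inE /S /= normrZ normfV normr_id mulVf // gt_eqF.
Qed.

Lemma covering_dim_theta0 : theta q = [set 0] ->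
  covering_dim R (asym_space q) = (\dim {:X})%:R%:E.
Proof.
move=> q0; rewrite dimvf -[RHS](covering_dim_rV (R := R)).
have [C C0 qC] := asym_norm_le_rV; have [c c0 qc] := asym_norm_ge_rV q0.
pose f (x : asym_space q) : 'rV[R]_n := v2r (x : X).
pose g (u : 'rV[R]_n) : asym_space q := (r2v u : X).
have cf : continuous f.
  apply/continuousP => U oU; apply/asym_openP => x Ux.
  have [e e0 eU] := open_ballP oU Ux; exists (c * e); first exact: mulr_gt0.
  move=> y; rewrite /asym_ball /= => yx; apply: eU.
  rewrite -(ltr_pM2l c0); apply: le_lt_trans (qc _) _.
  by rewrite linearB /= !v2rK.
have cg : continuous g.
  apply/continuousP => U /asym_openP oU; rewrite openE => u /oU[e e0 eU].
  apply/nbhs_ballP; exists (e / C); rewrite /= ?divr_gt0 // => v.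
  rewrite -ball_normE /ball_ /= distrC ltr_pdivlMr // mulrC => vu; apply: eU.
  by rewrite /asym_ball /= -linearB; apply: le_lt_trans (qC _) vu.
have fK : cancel f g by move=> x; apply: v2rK.
have gK : cancel g f by move=> x; apply: r2vK.
apply/eqP; rewrite eq_le (covering_dim_homeo_le cf cg fK gK).
exact: covering_dim_homeo_le cg cf gK fK.
Qed.

End NormEquivalence.

Theorem theorem5p9 (R : realType) (X : vectType R) (q : asymNorm X) :
  let Y := linear_span (theta q) in
  [/\ Y = [set: X] -> covering_dim R (asym_space q) = 0%E,
      Y <> [set 0] -> Y <> [set: X] -> covering_dim R (asym_space q) = +oo%E &
      Y = [set 0] -> covering_dim R (asym_space q) = (\dim {:X})%:R%:E].
Proof.
split; [exact: covering_dim_theta_full|exact: covering_dim_proper|move=> Y0].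
apply: covering_dim_theta0; apply/seteqP; split=> x.
  by move=> /linear_span_sub; rewrite Y0.
by move=> ->; apply: asym_norm0.
Qed.
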